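(* Let $n\ge 1$ and let $T_1,\dots,T_n$ be independent Bernoulli random variables, $T_i$ having parameter $q_i=P(T_i=1)\in[0,1]$. Let $\overline T=\frac1n\sum_{i=1}^n T_i$, $\overline q=\frac1n\sum_{i=1}^n q_i$, and let $0\le\alpha\le 1/2$. Define the random variable $$\hat q=\begin{cases} I^{-1}_{\alpha}\big(n\overline T-1,\; n(1-\overline T)+2\big) & \text{if } n\overline T\ge 1,\\ 0 & \text{if } n\overline T=0.\end{cases}$$ Then $P(\hat q\le \overline q)\ge 1-\alpha$, i.e. $[\hat q,1]$ is a confidence interval for $\overline q$ with confidence level $1-\alpha$.
   Context: $I_x(\mathsf a,\mathsf b)$ denotes the regularized incomplete Beta function (the cumulative distribution function at $x$ of the Beta$(\mathsf a,\mathsf b)$ distribution). $I^{-1}_\alpha(\mathsf a,\mathsf b)$ denotes its inverse in the first variable, i.e. the value $x\in[0,1]$ with $I_x(\mathsf a,\mathsf b)=\alpha$. When the first argument equals $0$ (the case $n\overline T=1$), $I^{-1}_\alpha(0,\mathsf b)$ is understood as $0$ (the limiting value, since $I_x(0,\mathsf b)=1$ for all $x>0$). *)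

(* Defs.v *)
From Stdlib Require Import Reals Lra Lia List.
Import ListNotations.
Open Scope R_scope.

Definition beta_kernel (a b : nat) (t : R) : R :=
  t ^ (a - 1) * (1 - t) ^ (b - 1).

Definition is_incbeta (a b : nat) (x v : R) : Prop :=
  exists (p1 : Riemann_integrable (beta_kernel a b) 0 x)
         (p2 : Riemann_integrable (beta_kernel a b) 0 1),
    v = RiemannInt p1 / RiemannInt p2.

Definition is_incbeta_inv (a b : nat) (alpha x : R) : Prop :=
  0 <= x <= 1 /\ is_incbeta a b x alpha.

Fixpoint bvecs (n : nat) : list (list bool) :=
  match n with
  | O => [[]]
  | S m => map (cons true) (bvecs m) ++ map (cons false) (bvecs m)
  end.

Fixpoint bern_weight (q : nat -> R) (i : nat) (t : list bool) : R :=
  match t with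
  | [] => 1
  | b :: t' => (if b then q i else 1 - q i) * bern_weight q (S i) t'
  end.

Definition nsucc (t : list bool) : nat := length (filter (fun b => b) t).

(* P(E(n Tbar)) for independent T_i ~ Bernoulli(q i), i = 0..n-1. *)
Definition prob_sum_event (n : nat) (q : nat -> R) (E : nat -> Prop)
  (Edec : forall k, {E k} + {~ E k}) : R :=
  fold_right Rplus 0
    (map (fun t => if Edec (nsucc t) then bern_weight q 0 t else 0) (bvecs n)).

Definition qbar (n : nat) (q : nat -> R) : R := sum_f_R0 q (n - 1) / INR n.

(* Main.v *)
(* For integers [1 <= m <= n], [I_x(m, n - m + 1) = P(Bin(n, x) >= m)], so [qhat k] is the [x]
   with [P(Bin(n, x) >= k - 1) = alpha]. Let [p = qbar], let [S] be the number of successes and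
   let [k] be least with [qhat k > p]. The interval misses [p] only if [S >= k], and
   [P(Bin(n, p) >= k - 1) < alpha <= 1/2]; so [P(S >= k) <= P(Bin(n, p) >= k - 1)] suffices.

   By Hoeffding (1956), [P(S >= k) <= P(Bin(n, p) >= k)] when [n p <= k - 1]. As a function of
   two parameters with fixed sum, [P(S >= k)] is affine in their product, with slope
   [P(S' = k - 2) - P(S' = k - 1)], [S'] counting the successes in the other trials. The slope
   is nonnegative if one of the two is the largest parameter of all, because
   [P(S' = j + 1) <= P(S' = j)] as soon as [j + 1] is at least the mean of [S'] plus a bound on
   its parameters. Replacing the largest parameter [y] and some [x <= p] by [p] and [x + y - p]
   therefore increases [P(S >= k)]; after finitely many such steps all parameters equal [p].

   The condition [n p <= k - 1] holds because [P(Bin(n, p) >= m) >= 1/2] whenever [m <= n p],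
   which is itself a consequence of Hoeffding's inequality. *)
Require Import Defs.
From Stdlib Require Import Reals RList Lra Lia List Permutation.
From Coquelicot Require Import Coquelicot.
Import List ListNotations.
Open Scope R_scope.

Definition lsum (l : list R) : R := fold_right Rplus 0 l.

Definition unit_list (l : list R) : Prop := Forall (fun x => 0 <= x <= 1) l.

Lemma convex_combination_le (x a b a' b' : R) :
  0 <= x <= 1 -> a <= a' -> b <= b' -> x * a + (1 - x) * b <= x * a' + (1 - x) * b'.
Proof. intros Hx Ha Hb. apply Rplus_le_compat; apply Rmult_le_compat_l; lra. Qed.

Lemma lsum_cons (x : R) (l : list R) : lsum (x :: l) = x + lsum l.
Proof. reflexivity. Qed.

Lemma lsum_app (l l' : list R) : lsum (l ++ l') = lsum l + lsum l'.
Proof. induction l as [|x l IH]; [simpl; ring|]. simpl app. rewrite !lsum_cons, IH. ring. Qed.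

Lemma lsum_repeat (x : R) (n : nat) : lsum (repeat x n) = INR n * x.
Proof.
  induction n as [|n IH]; [simpl; ring|].
  rewrite S_INR. simpl repeat. rewrite lsum_cons, IH. ring.
Qed.

Lemma lsum_perm (l l' : list R) : Permutation l l' -> lsum l = lsum l'.
Proof. induction 1; simpl in *; lra. Qed.

Lemma lsum_map_linear {A : Type} (a b : R) (f g : A -> R) (l : list A) :
  lsum (map (fun t => a * f t + b * g t) l) = a * lsum (map f l) + b * lsum (map g l).
Proof.
  induction l as [|x l IH]; [simpl; ring|]. rewrite !map_cons, !lsum_cons, IH. ring.
Qed.

Lemma lsum_map_scal {A : Type} (a : R) (f : A -> R) (l : list A) :
  lsum (map (fun t => a * f t) l) = a * lsum (map f l).
Proof.
  induction l as [|x l IH]; [simpl; ring|]. rewrite !map_cons, !lsum_cons, IH. ring.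
Qed.

Lemma lsum_nonneg (l : list R) : Forall (Rle 0) l -> 0 <= lsum l.
Proof. induction 1; [apply Rle_refl|]. rewrite lsum_cons. lra. Qed.

Lemma lsum_le_length (c : R) (l : list R) :
  (forall x, In x l -> x <= c) -> lsum l <= INR (length l) * c.
Proof.
  induction l as [|x l IH]; intros H; [simpl; lra|].
  rewrite lsum_cons. simpl length. rewrite S_INR.
  pose proof (H x (in_eq x l)). specialize (IH (fun y Hy => H y (in_cons x y l Hy))). lra.
Qed.

Lemma exists_le_mean (c : R) (l : list R) :
  l <> [] -> lsum l <= INR (length l) * c -> exists x, In x l /\ x <= c.
Proof.
  intros Hne; induction l as [|x l IH]; [easy|]. clear Hne.
  rewrite lsum_cons. simpl length. rewrite S_INR. intros Hs.
  destruct (Rle_lt_dec x c) as [Hx|Hx]; [exists x; split; [now left|exact Hx]|].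
  destruct l as [|y l]; [simpl in Hs; lra|].
  destruct IH as (z & Hz & Hzc); [easy|lra|]. exists z. split; [now right|exact Hzc].
Qed.

Lemma In_Permutation_cons {A : Type} (x : A) (l : list A) :
  In x l -> exists r, Permutation l (x :: r).
Proof.
  intros Hx. destruct (in_split x l Hx) as (l1 & l2 & ->).
  exists (l1 ++ l2). symmetry. apply Permutation_middle.
Qed.

Lemma unit_list_cons (x : R) (l : list R) :
  unit_list (x :: l) <-> 0 <= x <= 1 /\ unit_list l.
Proof. apply Forall_cons_iff. Qed.

Lemma unit_list_app (l l' : list R) :
  unit_list (l ++ l') <-> unit_list l /\ unit_list l'.
Proof. apply Forall_app. Qed.

Lemma unit_list_perm (l l' : list R) :
  Permutation l l' -> unit_list l -> unit_list l'.
Proof. apply Permutation_Forall. Qed.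

Lemma unit_list_repeat (x : R) (n : nat) : 0 <= x <= 1 -> unit_list (repeat x n).
Proof. intros H. apply Forall_forall. intros y Hy. apply repeat_spec in Hy. now subst. Qed.

Lemma unit_list_lsum (l : list R) : unit_list l -> 0 <= lsum l <= INR (length l).
Proof.
  intros Hl. split.
  - apply lsum_nonneg. revert Hl. apply Forall_impl. intros x Hx. apply Hx.
  - rewrite <- (Rmult_1_r (INR (length l))). apply lsum_le_length.
    intros x Hx. now apply (proj1 (Forall_forall _ l) Hl).
Qed.

Lemma unit_list_mean (l : list R) (p : R) :
  unit_list l -> (0 < length l)%nat -> lsum l = INR (length l) * p -> 0 <= p <= 1.
Proof.
  intros Hl Hn%lt_0_INR Hmean. pose proof (unit_list_lsum l Hl) as Hsum.
  rewrite Hmean in Hsum. split; nra.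
Qed.

(** * Poisson binomial distributions *)

(* "pb" stands for the Poisson binomial distribution: [pb_expect l f] is the expectation of
   [f S], where [S] counts the successes in independent Bernoulli trials with parameters [l]. *)
Fixpoint pb_expect (l : list R) (f : nat -> R) : R :=
  match l with
  | [] => f 0%nat
  | x :: l' => x * pb_expect l' (fun k => f (S k)) + (1 - x) * pb_expect l' f
  end.

Definition pb_tail (l : list R) (k : nat) : R :=
  pb_expect l (fun j => if (k <=? j)%nat then 1 else 0).

Definition pb_pmf (l : list R) (k : nat) : R :=
  pb_expect l (fun j => if (j =? k)%nat then 1 else 0).

Definition binomial_tail (n : nat) (p : R) (k : nat) : R := pb_tail (repeat p n) k.

Lemma pb_expect_cons (x : R) (l : list R) (f : nat -> R) :
  pb_expect (x :: l) f = x * pb_expect l (fun k => f (S k)) + (1 - x) * pb_expect l f.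
Proof. reflexivity. Qed.

Lemma pb_expect_ext (l : list R) (f g : nat -> R) :
  (forall k, (k <= length l)%nat -> f k = g k) -> pb_expect l f = pb_expect l g.
Proof.
  revert f g; induction l as [|x l IH]; intros f g H; simpl in *; [now apply H|].
  f_equal; f_equal; apply IH; intros k Hk; apply H; lia.
Qed.

Lemma pb_expect_linear (a b : R) (l : list R) (f g : nat -> R) :
  pb_expect l (fun k => a * f k + b * g k) = a * pb_expect l f + b * pb_expect l g.
Proof.
  revert f g; induction l as [|x l IH]; intros f g; simpl; [reflexivity|].
  rewrite (IH f g), (IH (fun k => f (S k)) (fun k => g (S k))). ring.
Qed.

Lemma pb_expect_minus (l : list R) (f g : nat -> R) :
  pb_expect l (fun k => f k - g k) = pb_expect l f - pb_expect l g.
Proof.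
  transitivity (1 * pb_expect l f + -1 * pb_expect l g); [|ring].
  rewrite <- pb_expect_linear. apply pb_expect_ext. intros k _. ring.
Qed.

Lemma pb_expect_const (l : list R) (c : R) : pb_expect l (fun _ => c) = c.
Proof. induction l as [|x l IH]; simpl; [reflexivity|]. rewrite IH. ring. Qed.

Lemma pb_expect_le (l : list R) (f g : nat -> R) :
  unit_list l -> (forall k, (k <= length l)%nat -> f k <= g k) ->
  pb_expect l f <= pb_expect l g.
Proof.
  intros Hl; revert f g; induction Hl as [|x l Hx _ IH]; intros f g H; simpl in *.
  - now apply H.
  - apply convex_combination_le; [exact Hx| |]; apply IH; intros k Hk; apply H; lia.
Qed.

Lemma pb_expect_perm (l l' : list R) :
  Permutation l l' -> forall f, pb_expect l f = pb_expect l' f.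
Proof.
  induction 1 as [|x l l' _ IH|x y l|l l' l'' _ IH _ IH']; intros f; simpl.
  - reflexivity.
  - now rewrite !IH.
  - ring.
  - now rewrite IH.
Qed.

Lemma pb_expect_complement (l : list R) (f : nat -> R) :
  pb_expect (map (Rminus 1) l) f = pb_expect l (fun k => f (length l - k)%nat).
Proof.
  revert f; induction l as [|x l IH]; intros f; [reflexivity|].
  rewrite map_cons, !pb_expect_cons, !IH. simpl length.
  rewrite (pb_expect_ext l (fun k => f (S (length l) - k)%nat)
             (fun k => f (S (length l - k)))).
  - simpl. ring.
  - intros k Hk. f_equal. lia.
Qed.

Lemma pb_expect_app_ones (a : nat) (l : list R) (f : nat -> R) :
  pb_expect (repeat 1 a ++ l) f = pb_expect l (fun k => f (a + k)%nat).
Proof.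
  revert f; induction a as [|a IH]; intros f; [reflexivity|].
  simpl app. rewrite pb_expect_cons, !IH. simpl. ring.
Qed.

Lemma pb_expect_app_zeros (b : nat) (l : list R) (f : nat -> R) :
  pb_expect (repeat 0 b ++ l) f = pb_expect l f.
Proof.
  revert f; induction b as [|b IH]; intros f; [reflexivity|].
  simpl app. rewrite pb_expect_cons, !IH. ring.
Qed.

Lemma pb_tail_cons_S (x : R) (l : list R) (k : nat) :
  pb_tail (x :: l) (S k) = x * pb_tail l k + (1 - x) * pb_tail l (S k).
Proof. reflexivity. Qed.

Lemma pb_tail_antitone (l : list R) (j k : nat) :
  unit_list l -> (j <= k)%nat -> pb_tail l k <= pb_tail l j.
Proof.
  intros Hl Hjk. apply pb_expect_le; [exact Hl|]. intros i _.
  destruct (Nat.leb_spec k i), (Nat.leb_spec j i); lra || lia.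
Qed.

Lemma pb_tail_gt_length (l : list R) (k : nat) : (length l < k)%nat -> pb_tail l k = 0.
Proof.
  intros Hk. rewrite <- (pb_expect_const l 0). apply pb_expect_ext. intros j Hj.
  destruct (Nat.leb_spec k j); [lia|reflexivity].
Qed.

Lemma pb_tail_complement (l : list R) (j k : nat) :
  (j + k = S (length l))%nat -> pb_tail l j + pb_tail (map (Rminus 1) l) k = 1.
Proof.
  intros Hjk.
  enough (Hc : pb_tail (map (Rminus 1) l) k = 1 - pb_tail l j) by (rewrite Hc; ring).
  rewrite <- (pb_expect_const l 1) at 2. unfold pb_tail.
  rewrite pb_expect_complement, <- pb_expect_minus. apply pb_expect_ext. intros i Hi.
  destruct (Nat.leb_spec j i), (Nat.leb_spec k (length l - i)); lra || lia.
Qed.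

Lemma pb_tail_perm (l l' : list R) (k : nat) : Permutation l l' -> pb_tail l k = pb_tail l' k.
Proof. intros HP. now apply pb_expect_perm. Qed.

Lemma pb_pmf_tail (l : list R) (k : nat) : pb_pmf l k = pb_tail l k - pb_tail l (S k).
Proof.
  unfold pb_tail. rewrite <- pb_expect_minus. apply pb_expect_ext. intros j _.
  destruct (Nat.eqb_spec j k), (Nat.leb_spec k j), (Nat.leb_spec (S k) j); lra || lia.
Qed.

Lemma pb_pmf_cons_0 (x : R) (l : list R) : pb_pmf (x :: l) 0 = (1 - x) * pb_pmf l 0.
Proof. unfold pb_pmf. simpl. rewrite pb_expect_const. ring. Qed.

Lemma pb_pmf_cons_S (x : R) (l : list R) (k : nat) :
  pb_pmf (x :: l) (S k) = x * pb_pmf l k + (1 - x) * pb_pmf l (S k).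
Proof. reflexivity. Qed.

Lemma pb_pmf_nonneg (l : list R) (k : nat) : unit_list l -> 0 <= pb_pmf l k.
Proof.
  intros Hl. rewrite <- (pb_expect_const l 0). apply pb_expect_le; [exact Hl|].
  intros j _. destruct (j =? k)%nat; lra.
Qed.

Lemma pb_pmf_perm (l l' : list R) (k : nat) : Permutation l l' -> pb_pmf l k = pb_pmf l' k.
Proof. intros HP. now apply pb_expect_perm. Qed.

Lemma pb_pmf_gt_length (l : list R) (k : nat) : (length l < k)%nat -> pb_pmf l k = 0.
Proof. intros Hk. rewrite pb_pmf_tail, !pb_tail_gt_length by lia. ring. Qed.

Lemma pb_expect_pmf (c : nat -> R) (l : list R) (k : nat) :
  pb_expect l (fun j => c j * if (j =? k)%nat then 1 else 0) = c k * pb_pmf l k.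
Proof.
  transitivity (c k * pb_pmf l k + 0 * pb_pmf l k); [|ring].
  unfold pb_pmf. rewrite <- pb_expect_linear. apply pb_expect_ext. intros j _.
  destruct (Nat.eqb_spec j k) as [->|]; ring.
Qed.

Lemma pb_pmf_unimodal (l : list R) (i j : nat) :
  unit_list l -> (i <= j)%nat ->
  pb_pmf l (S i) < pb_pmf l i -> pb_pmf l (S j) <= pb_pmf l j.
Proof.
  intros Hunit; revert i j; induction Hunit as [|x l Hx Hl IH]; intros i j Hij Hi.
  - rewrite (pb_pmf_gt_length [] (S j)) by (simpl; lia). apply pb_pmf_nonneg, Forall_nil.
  - destruct (Nat.eq_dec i j) as [->|Hne]; [lra|].
    destruct j as [|j]; [lia|].
    assert (Hfall : exists i', (i' <= j)%nat /\ pb_pmf l (S i') < pb_pmf l i').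
    { destruct i as [|i].
      - rewrite pb_pmf_cons_0, pb_pmf_cons_S in Hi. exists 0%nat. split; [lia|].
        apply Rnot_le_lt. intros Hrise. pose proof (pb_pmf_nonneg l 0 Hl). nra.
      - rewrite !pb_pmf_cons_S in Hi.
        destruct (Rlt_le_dec (pb_pmf l (S i)) (pb_pmf l i)) as [Hfall|Hrise];
          [exists i; auto with arith|].
        exists (S i). split; [lia|]. apply Rnot_le_lt. intros Hrise'.
        pose proof (convex_combination_le x _ _ _ _ Hx Hrise Hrise'). lra. }
    destruct Hfall as (i' & Hi'j & Hfall). rewrite !pb_pmf_cons_S.
    apply convex_combination_le; [exact Hx| |]; apply (IH i'); auto with arith.
Qed.

(** * Removing a trial *)

Fixpoint removals {A : Type} (l : list A) : list (A * list A) :=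
  match l with
  | [] => []
  | x :: l' => (x, l') :: map (fun c => (fst c, x :: snd c)) (removals l')
  end.

Lemma map_fst_removals {A : Type} (l : list A) : map fst (removals l) = l.
Proof.
  induction l as [|x l IH]; [reflexivity|].
  simpl. f_equal. rewrite map_map. exact IH.
Qed.

Lemma length_removals {A : Type} (l : list A) : length (removals l) = length l.
Proof. rewrite <- (length_map fst (removals l)). now rewrite map_fst_removals. Qed.

Lemma Permutation_removals {A : Type} (l : list A) (x : A) (r : list A) :
  In (x, r) (removals l) -> Permutation l (x :: r).
Proof.
  revert r; induction l as [|y l IH]; intros r; simpl; [easy|].
  intros [E|H]; [injection E as -> ->; reflexivity|].
  apply in_map_iff in H. destruct H as ([z s] & E & Hs). simpl in E. injection E as -> <-.
  rewrite (IH s Hs). apply perm_swap.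
Qed.

(* In [E (S g(S))] the factor [S] is split as the sum of the Bernoulli variables. *)
Lemma lsum_removals_success (l : list R) (g : nat -> R) :
  lsum (map (fun c => fst c * pb_expect (snd c) (fun k => g (S k))) (removals l))
  = pb_expect l (fun k => INR k * g k).
Proof.
  revert g; induction l as [|x l IH]; intros g; [simpl; ring|].
  simpl removals. rewrite map_cons, lsum_cons, map_map. cbn [fst snd].
  rewrite (map_ext _ (fun c => x * (fst c * pb_expect (snd c) (fun k => g (S (S k))))
                               + (1 - x) * (fst c * pb_expect (snd c) (fun k => g (S k)))))
    by (intros c; rewrite pb_expect_cons; ring).
  rewrite lsum_map_linear, (IH g), (IH (fun k => g (S k))), pb_expect_cons.
  rewrite (pb_expect_ext l (fun k => INR (S k) * g (S k))
             (fun k => 1 * g (S k) + 1 * (INR k * g (S k))))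
    by (intros k _; rewrite S_INR; ring).
  rewrite pb_expect_linear. ring.
Qed.

Lemma lsum_removals_failure (l : list R) (g : nat -> R) :
  lsum (map (fun c => (1 - fst c) * pb_expect (snd c) g) (removals l))
  = pb_expect l (fun k => (INR (length l) - INR k) * g k).
Proof.
  rewrite (map_ext_in _ (fun c => 1 * pb_expect l g
             + -1 * (fst c * pb_expect (snd c) (fun k => g (S k))))).
  2:{ intros [x r] Hc. rewrite (pb_expect_perm l (x :: r) (Permutation_removals l x r Hc)).
      simpl. ring. }
  rewrite lsum_map_linear, lsum_removals_success, map_const, lsum_repeat, length_removals.
  rewrite (pb_expect_ext l (fun k => (INR (length l) - INR k) * g k)
             (fun k => INR (length l) * g k + -1 * (INR k * g k))) by (intros; ring).
  rewrite pb_expect_linear. ring.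
Qed.

Lemma lsum_removals_success_pmf (l : list R) (k : nat) :
  lsum (map (fun c => fst c * pb_pmf (snd c) k) (removals l)) = INR (S k) * pb_pmf l (S k).
Proof.
  rewrite <- (pb_expect_pmf INR l (S k)).
  exact (lsum_removals_success l (fun j => if (j =? S k)%nat then 1 else 0)).
Qed.

Lemma lsum_removals_failure_pmf (l : list R) (k : nat) :
  lsum (map (fun c => (1 - fst c) * pb_pmf (snd c) k) (removals l))
  = (INR (length l) - INR k) * pb_pmf l k.
Proof.
  rewrite <- (pb_expect_pmf (fun j => INR (length l) - INR j) l k).
  apply lsum_removals_failure.
Qed.

(** * Monotonicity of the weights beyond the mean *)

Lemma pb_pmf_rise_le_removal (x : R) (l : list R) (k : nat) :
  unit_list (x :: l) -> pb_pmf (x :: l) k < pb_pmf (x :: l) (S k) ->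
  pb_pmf (x :: l) k <= pb_pmf l k.
Proof.
  intros [Hx Hl]%unit_list_cons Hrise. apply Rnot_lt_le. intros Hdrop.
  pose proof (pb_pmf_nonneg l k Hl).
  destruct k as [|k]; rewrite ?pb_pmf_cons_0, ?pb_pmf_cons_S in *; [nra|].
  assert (Hfall : pb_pmf l (S k) < pb_pmf l k) by nra.
  pose proof (pb_pmf_unimodal l k (S k) Hl ltac:(lia) Hfall). nra.
Qed.

(* Sum over the trials of [(a - x) (P(S' = k) - P(S = k))], [S'] being the number of successes
   without the trial of parameter [x]; while the weights increase, every term is nonnegative. *)
Lemma pb_pmf_rise_bound (a : R) (l : list R) (k : nat) :
  unit_list l -> (forall x, In x l -> x <= a) -> pb_pmf l k < pb_pmf l (S k) ->
  (1 - a) * INR (S k) * pb_pmf l (S k) <= (lsum l - a * INR k) * pb_pmf l k.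
Proof.
  intros Hl Ha Hrise.
  assert (Hsum : 0 <= lsum (map (fun c => (a - fst c) * (pb_pmf (snd c) k - pb_pmf l k))
                              (removals l))).
  { apply lsum_nonneg, Forall_map, Forall_forall. intros [x r] Hc. cbn [fst snd].
    assert (HP := Permutation_removals l x r Hc).
    assert (Hpmf : forall j, pb_pmf l j = pb_pmf (x :: r) j)
      by (intros j; now apply pb_pmf_perm).
    rewrite !Hpmf in *.
    pose proof (pb_pmf_rise_le_removal x r k (unit_list_perm _ _ HP Hl) Hrise).
    assert (x <= a) by (apply Ha; rewrite HP; now left).
    apply Rmult_le_pos; lra. }
  rewrite (map_ext _ (fun c =>
    1 * (a * ((1 - fst c) * pb_pmf (snd c) k) + (a - 1) * (fst c * pb_pmf (snd c) k))
    + pb_pmf l k * (1 * fst c + - a * 1))) in Hsum by (intros c; ring).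
  rewrite !lsum_map_linear, lsum_removals_success_pmf, lsum_removals_failure_pmf in Hsum.
  rewrite map_fst_removals, map_const, lsum_repeat, length_removals in Hsum. lra.
Qed.

Lemma pb_pmf_noninc_of_bound_lt_1 (a : R) (l : list R) (k : nat) :
  unit_list l -> (forall x, In x l -> x <= a) -> a < 1 -> lsum l + a <= INR (S k) ->
  pb_pmf l (S k) <= pb_pmf l k.
Proof.
  intros Hl Ha Ha1 Hmean. apply Rnot_lt_le. intros Hrise.
  pose proof (pb_pmf_rise_bound a l k Hl Ha Hrise) as Hbound.
  pose proof (pb_pmf_nonneg l k Hl). pose proof (pos_INR k). rewrite S_INR in *.
  assert ((lsum l - a * INR k) * pb_pmf l k <= (1 - a) * (INR k + 1) * pb_pmf l k)
    by (apply Rmult_le_compat_r; lra).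
  assert ((1 - a) * (INR k + 1) * pb_pmf l k < (1 - a) * (INR k + 1) * pb_pmf l (S k))
    by (apply Rmult_lt_compat_l; [apply Rmult_lt_0_compat; lra|exact Hrise]).
  lra.
Qed.

Lemma pb_pmf_noninc_no_sure_success (l : list R) (k : nat) :
  unit_list l -> ~ In 1 l -> lsum l <= INR k -> pb_pmf l (S k) <= pb_pmf l k.
Proof.
  intros Hl Hno1 Hmean. destruct l as [|x l].
  { now rewrite (pb_pmf_gt_length [] (S k)) by (simpl; lia); apply pb_pmf_nonneg. }
  assert (Hmax : In (MaxRlist (x :: l)) (x :: l)) by (apply MaxRlist_P2; exists x; now left).
  destruct (proj1 (Forall_forall _ _) Hl _ Hmax) as [_ [Hlt|Heq]]; [|now rewrite Heq in Hmax].
  apply (pb_pmf_noninc_of_bound_lt_1 (MaxRlist (x :: l))); auto using MaxRlist_P1.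
  rewrite S_INR. lra.
Qed.

Lemma pb_pmf_noninc_after_mean (l : list R) (k : nat) :
  unit_list l -> lsum l <= INR k -> pb_pmf l (S k) <= pb_pmf l k.
Proof.
  revert l; induction k as [|k IH]; intros l Hl Hmean;
    (destruct (in_dec Req_dec_T 1 l) as [Hin1|Hno1];
      [|now apply pb_pmf_noninc_no_sure_success]);
    destruct (In_Permutation_cons 1 l Hin1) as [r HP];
    assert (Hr := unit_list_perm _ _ HP Hl); apply unit_list_cons in Hr as [_ Hr];
    rewrite (lsum_perm _ _ HP), lsum_cons in Hmean.
  - apply unit_list_lsum in Hr. simpl in Hmean. lra.
  - rewrite !(pb_pmf_perm _ _ _ HP), !pb_pmf_cons_S. rewrite S_INR in Hmean.
    specialize (IH r Hr ltac:(lra)). lra.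
Qed.

Lemma pb_pmf_noninc_of_bound (a : R) (l : list R) (k : nat) :
  unit_list l -> (forall x, In x l -> x <= a) -> a <= 1 -> lsum l + a <= INR (S k) ->
  pb_pmf l (S k) <= pb_pmf l k.
Proof.
  intros Hl Ha [Ha1| ->] Hmean; [now apply (pb_pmf_noninc_of_bound_lt_1 a)|].
  apply pb_pmf_noninc_after_mean; [exact Hl|]. rewrite S_INR in Hmean. lra.
Qed.

(** * Hoeffding's inequality *)

Lemma pb_tail_cons_cons (x y : R) (l : list R) (k : nat) :
  pb_tail (x :: y :: l) (S (S k)) =
  pb_tail l (S (S k)) + (x + y) * pb_pmf l (S k) + x * y * (pb_pmf l k - pb_pmf l (S k)).
Proof. rewrite !pb_pmf_tail, !pb_tail_cons_S. ring. Qed.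

Lemma pb_tail_smoothing (x y x' y' : R) (l : list R) (k : nat) :
  x' + y' = x + y -> x * y <= x' * y' -> pb_pmf l (S k) <= pb_pmf l k ->
  pb_tail (x :: y :: l) (S (S k)) <= pb_tail (x' :: y' :: l) (S (S k)).
Proof.
  intros Hsum Hprod Hpmf. rewrite !pb_tail_cons_cons, Hsum.
  apply Rplus_le_compat_l, Rmult_le_compat_r; lra.
Qed.

Lemma pb_tail_equalize_pair (p x y : R) (l : list R) (k : nat) :
  unit_list (x :: y :: l) -> x <= p <= y -> (forall z, In z l -> z <= y) ->
  lsum (x :: y :: l) <= INR (S k) ->
  pb_tail (x :: y :: l) (S (S k)) <= pb_tail (p :: x + y - p :: l) (S (S k)).
Proof.
  intros [Hx [Hy Hl]%unit_list_cons]%unit_list_cons Hp Hmax Hmean.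
  apply pb_tail_smoothing; [ring|nra|].
  apply (pb_pmf_noninc_of_bound y); [exact Hl|exact Hmax|lra|].
  rewrite !lsum_cons in Hmean. lra.
Qed.

Lemma Permutation_max_below_mean (p : R) (l : list R) :
  (2 <= length l)%nat -> lsum l = INR (length l) * p ->
  exists x y r, Permutation l (x :: y :: r) /\ x <= p <= y /\ forall z, In z r -> z <= y.
Proof.
  intros Hlen Hmean. set (y := MaxRlist l).
  assert (Hmax : forall z, In z l -> z <= y) by apply MaxRlist_P1.
  assert (Hy : In y l).
  { apply MaxRlist_P2. destruct l as [|z l]; [simpl in Hlen; lia|]. exists z. now left. }
  assert (Hpy : p <= y).
  { pose proof (lsum_le_length y l Hmax). apply (Rmult_le_reg_l (INR (length l))); [|lra].
    apply lt_0_INR. lia. }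
  destruct (In_Permutation_cons y l Hy) as [s HPs].
  rewrite (lsum_perm _ _ HPs), (Permutation_length HPs) in Hmean.
  rewrite (Permutation_length HPs) in Hlen. simpl length in *.
  rewrite lsum_cons, S_INR in Hmean.
  destruct (exists_le_mean p s) as (x & Hx & Hxp);
    [now destruct s; [simpl in Hlen; lia|]|lra|].
  destruct (In_Permutation_cons x s Hx) as [r HPr].
  exists x, y, r. rewrite HPs, HPr. split; [apply perm_swap|]. split; [now split|].
  intros z Hz. apply Hmax. rewrite HPs, HPr. simpl. tauto.
Qed.

Lemma pb_tail_le_equalized (p : R) (m : nat) (l : list R) (k : nat) :
  0 <= p <= 1 -> unit_list l -> lsum l = INR (length l) * p ->
  INR (m + length l) * p <= INR (S k) ->
  pb_tail (repeat p m ++ l) (S (S k)) <= binomial_tail (m + length l) p (S (S k)).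
Proof.
  intros Hp. remember (length l) as n eqn:Hn. revert m l Hn.
  induction n as [|n IH]; intros m l Hn Hl Hmean Hk.
  { symmetry in Hn. apply length_zero_iff_nil in Hn. subst l.
    rewrite app_nil_r, Nat.add_0_r. apply Rle_refl. }
  destruct n as [|n].
  { destruct l as [|x [|? ?]]; try discriminate. simpl in Hmean.
    replace x with p by lra. unfold binomial_tail. rewrite repeat_app. apply Rle_refl. }
  destruct (Permutation_max_below_mean p l) as (x & y & r & HP & [Hx Hy] & Hmax);
    [lia|now rewrite <- Hn|].
  assert (Hunit := unit_list_perm _ _ HP Hl).
  apply unit_list_cons in Hunit as [Hx01 Hunit]. apply unit_list_cons in Hunit as [Hy01 Hr].
  assert (Hlen : length r = n) by (apply Permutation_length in HP; simpl in HP; lia).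
  rewrite (lsum_perm _ _ HP), !lsum_cons, !S_INR in Hmean.
  rewrite plus_INR, !S_INR in Hk.
  apply Rle_trans with (pb_tail (repeat p (S m) ++ x + y - p :: r) (S (S k))).
  - rewrite (pb_tail_perm (repeat p m ++ l) (x :: y :: repeat p m ++ r))
      by (rewrite HP; now rewrite !Permutation_middle).
    rewrite (pb_tail_perm (repeat p (S m) ++ x + y - p :: r)
                            (p :: x + y - p :: repeat p m ++ r))
      by (simpl; constructor; symmetry; apply Permutation_middle).
    apply pb_tail_equalize_pair; [|now split| |].
    + rewrite !unit_list_cons, unit_list_app. auto using unit_list_repeat.
    + intros z [Hz|Hz]%in_app_iff; [apply repeat_spec in Hz; now subst z|auto].
    + rewrite !lsum_cons, lsum_app, lsum_repeat, S_INR. lra.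
  - replace (m + S (S n))%nat with (S m + S n)%nat by lia. apply IH.
    + simpl. now rewrite Hlen.
    + apply unit_list_cons. split; [lra|exact Hr].
    + rewrite lsum_cons, S_INR. lra.
    + rewrite plus_INR, !S_INR. lra.
Qed.

Lemma pb_tail_le_binomial_tail (p : R) (l : list R) (k : nat) :
  0 <= p <= 1 -> unit_list l -> lsum l = INR (length l) * p -> lsum l <= INR (S k) ->
  pb_tail l (S (S k)) <= binomial_tail (length l) p (S (S k)).
Proof.
  intros Hp Hl Hmean Hk. apply (pb_tail_le_equalized p 0); auto.
  now rewrite Nat.add_0_l, <- Hmean.
Qed.

(** * Binomial tails and the incomplete Beta function *)

Lemma is_derive_convex_combination (f g : R -> R) (x df dg : R) :
  is_derive f x df -> is_derive g x dg ->
  is_derive (fun y => y * f y + (1 - y) * g y) x (f x - g x + x * df + (1 - x) * dg).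
Proof.
  intros Hf Hg. auto_derive; [repeat split; eexists; eassumption|].
  rewrite (is_derive_unique (fun y : R => f y) x df Hf).
  rewrite (is_derive_unique (fun y : R => g y) x dg Hg). ring.
Qed.

Lemma is_derive_pb_expect_repeat (n : nat) (f : nat -> R) (x : R) :
  is_derive (fun y => pb_expect (repeat y n) f) x
    (INR n * pb_expect (repeat x (pred n)) (fun k => f (S k) - f k)).
Proof.
  revert f; induction n as [|n IH]; intros f.
  - simpl. rewrite Rmult_0_l. exact (is_derive_const (f 0%nat) x).
  - simpl repeat. simpl pred.
    evar_last;
      [apply (is_derive_convex_combination (fun y => pb_expect (repeat y n) (fun k => f (S k)))
                                           (fun y => pb_expect (repeat y n) f)); apply IH|].
    assert (Hdiff : pb_expect (repeat x n) (fun k => f (S k) - f k)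
      = pb_expect (repeat x n) (fun k => f (S k)) - pb_expect (repeat x n) f)
      by apply pb_expect_minus.
    rewrite <- Hdiff, S_INR. destruct n as [|n]; [simpl; ring|].
    simpl repeat. simpl pred. rewrite (pb_expect_cons x _ (fun k => f (S k) - f k)). ring.
Qed.

Lemma is_derive_binomial_tail (n m : nat) (x : R) :
  is_derive (fun y => binomial_tail n y (S m)) x (INR n * pb_pmf (repeat x (pred n)) m).
Proof.
  evar_last; [apply is_derive_pb_expect_repeat|]. f_equal. apply pb_expect_ext. intros k _.
  destruct (Nat.eqb_spec k m), (Nat.leb_spec (S m) (S k)), (Nat.leb_spec (S m) k); lra || lia.
Qed.

Lemma pb_pmf_repeat (n k : nat) (x : R) :
  (k <= n)%nat -> pb_pmf (repeat x n) k = Binomial.C n k * (x ^ k * (1 - x) ^ (n - k)).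
Proof.
  revert k; induction n as [|n IH]; intros k Hk.
  - replace k with 0%nat by lia. rewrite C_n_n. unfold pb_pmf. simpl. ring.
  - simpl repeat. destruct k as [|k].
    + rewrite pb_pmf_cons_0, IH, !C_n_0, !Nat.sub_0_r by lia. simpl. ring.
    + rewrite pb_pmf_cons_S, IH by lia. simpl Nat.sub.
      destruct (Nat.eq_dec k n) as [->|Hkn].
      * rewrite pb_pmf_gt_length by (rewrite repeat_length; lia).
        rewrite !C_n_n, Nat.sub_diag. simpl. ring.
      * rewrite IH, <- pascal by lia.
        replace (n - k)%nat with (S (n - S k)) by lia. simpl. ring.
Qed.

(* The inverse of the Beta function at [(m, n - m + 1)]. *)
Definition inv_Beta (n m : nat) : R := INR n * Binomial.C (n - 1) (m - 1).

Lemma inv_Beta_pos (n m : nat) : (1 <= n)%nat -> 0 < inv_Beta n m.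
Proof.
  intros Hn. apply Rmult_lt_0_compat; [apply lt_0_INR; lia|].
  apply Rdiv_lt_0_compat; [|apply Rmult_lt_0_compat]; apply INR_fact_lt_0.
Qed.

Lemma is_derive_binomial_tail_Beta (n m : nat) (x : R) :
  (1 <= m <= n)%nat ->
  is_derive (fun y => binomial_tail n y m) x (inv_Beta n m * beta_kernel m (n - m + 1) x).
Proof.
  intros Hm. destruct m as [|m]; [lia|].
  evar_last; [apply is_derive_binomial_tail|].
  rewrite pb_pmf_repeat by lia. unfold inv_Beta, beta_kernel.
  replace (S m - 1)%nat with m by lia.
  replace (n - S m + 1 - 1)%nat with (n - 1 - m)%nat by lia.
  rewrite Nat.sub_1_r. ring.
Qed.

Lemma beta_kernel_pos (a b : nat) (x : R) : 0 < x < 1 -> 0 < beta_kernel a b x.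
Proof. intros Hx. apply Rmult_lt_0_compat; apply pow_lt; lra. Qed.

Lemma binomial_tail_strictly_increasing (n m : nat) (x y : R) :
  (1 <= m <= n)%nat -> 0 <= x -> x < y -> y <= 1 ->
  binomial_tail n x m < binomial_tail n y m.
Proof.
  intros Hm Hx Hxy Hy.
  destruct (MVT_cor2 (fun t => binomial_tail n t m)
              (fun t => inv_Beta n m * beta_kernel m (n - m + 1) t) x y Hxy)
    as (z & Hz & Hxzy).
  { intros t _. apply is_derive_Reals, is_derive_binomial_tail_Beta, Hm. }
  enough (0 < inv_Beta n m * beta_kernel m (n - m + 1) z * (y - x)) by lra.
  apply Rmult_lt_0_compat; [apply Rmult_lt_0_compat|lra].
  - apply inv_Beta_pos. lia.
  - apply beta_kernel_pos. lra.
Qed.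

Lemma binomial_tail_nondecreasing (n m : nat) (x y : R) :
  (1 <= m <= n)%nat -> 0 <= x -> x <= y -> y <= 1 ->
  binomial_tail n x m <= binomial_tail n y m.
Proof.
  intros Hm Hx [Hxy| ->] Hy; [left|apply Rle_refl].
  now apply binomial_tail_strictly_increasing.
Qed.

Lemma binomial_tail_at_0 (n m : nat) : (1 <= m)%nat -> binomial_tail n 0 m = 0.
Proof.
  intros Hm. unfold binomial_tail, pb_tail. rewrite <- (app_nil_r (repeat 0 n)).
  rewrite pb_expect_app_zeros. destruct m; [lia|reflexivity].
Qed.

Lemma binomial_tail_at_1 (n m : nat) : (m <= n)%nat -> binomial_tail n 1 m = 1.
Proof.
  intros Hm. unfold binomial_tail, pb_tail. rewrite <- (app_nil_r (repeat 1 n)).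
  rewrite pb_expect_app_ones. simpl. destruct (Nat.leb_spec m (n + 0)); [reflexivity|lia].
Qed.

Lemma beta_kernel_continuous (a b : nat) (x : R) : continuous (beta_kernel a b) x.
Proof.
  apply (ex_derive_continuous (beta_kernel a b)). unfold beta_kernel. now auto_derive.
Qed.

Lemma is_RInt_beta_kernel (n m : nat) (x : R) :
  (1 <= m <= n)%nat ->
  is_RInt (beta_kernel m (n - m + 1)) 0 x (binomial_tail n x m / inv_Beta n m).
Proof.
  intros Hm. pose proof (inv_Beta_pos n m ltac:(lia)) as Hc.
  evar_last.
  - apply (is_RInt_derive (fun t => / inv_Beta n m * binomial_tail n t m)).
    + intros t _. evar_last.
      * apply is_derive_scal, is_derive_binomial_tail_Beta, Hm.
      * field. lra.
    + intros t _. apply beta_kernel_continuous.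
  - rewrite binomial_tail_at_0 by lia. unfold minus, plus, opp. simpl. field. lra.
Qed.

Lemma is_incbeta_eq_binomial_tail (n m : nat) (x v : R) :
  (1 <= m <= n)%nat -> is_incbeta m (n - m + 1) x v -> v = binomial_tail n x m.
Proof.
  intros Hm (p1 & p2 & ->). rewrite <- !RInt_Reals.
  rewrite !(is_RInt_unique _ _ _ _ (is_RInt_beta_kernel n m _ Hm)), binomial_tail_at_1 by lia.
  field. pose proof (inv_Beta_pos n m ltac:(lia)). lra.
Qed.

Lemma binomial_tail_lt_of_lt_incbeta_inv (n m : nat) (alpha p x : R) :
  (1 <= m <= n)%nat -> is_incbeta_inv m (n - m + 1) alpha x -> 0 <= p -> p < x ->
  binomial_tail n p m < alpha.
Proof.
  intros Hm [Hx Hinc] Hp Hpx. rewrite (is_incbeta_eq_binomial_tail n m x alpha Hm Hinc).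
  apply binomial_tail_strictly_increasing; lra || assumption.
Qed.

(** * Medians *)

Lemma binomial_tail_fair (n : nat) : binomial_tail (2 * n) (1 / 2) (S n) <= 1 / 2.
Proof.
  unfold binomial_tail. set (l := repeat (1 / 2) (2 * n)).
  assert (Hsym : map (Rminus 1) l = l) by (unfold l; rewrite map_repeat; f_equal; lra).
  assert (Hsum : pb_tail l n + pb_tail l (S n) = 1).
  { rewrite <- Hsym at 2. apply pb_tail_complement. unfold l. rewrite repeat_length. lia. }
  assert (Hle : pb_tail l (S n) <= pb_tail l n).
  { apply pb_tail_antitone; [apply unit_list_repeat; lra|lia]. }
  lra.
Qed.

Lemma pb_tail_app_ones_zeros (a b : nat) (l : list R) (k : nat) :
  pb_tail (repeat 1 a ++ repeat 0 b ++ l) (a + k) = pb_tail l k.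
Proof.
  unfold pb_tail. rewrite pb_expect_app_ones, pb_expect_app_zeros.
  apply pb_expect_ext. intros j _.
  destruct (Nat.leb_spec (a + k) (a + j)), (Nat.leb_spec k j); reflexivity || lia.
Qed.

(* Sure successes and sure failures are appended until the threshold is half the number of
   trials: there the extremal binomial distribution is symmetric. *)
Lemma pb_tail_le_half (l : list R) (k : nat) :
  unit_list l -> lsum l <= INR k -> pb_tail l (S k) <= 1 / 2.
Proof.
  intros Hl Hk. set (n := length l). set (M := S (n + k)).
  set (padded := repeat 1 (S n) ++ repeat 0 (S (2 * k)) ++ l).
  assert (Hlen : length padded = (2 * M)%nat).
  { unfold padded. rewrite !length_app, !repeat_length. fold n. lia. }
  assert (Hunit : unit_list padded).
  { unfold padded. rewrite !unit_list_app. repeat split; [| |exact Hl];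
      apply unit_list_repeat; lra. }
  assert (Hmean : lsum padded <= INR M).
  { unfold padded, M. rewrite !lsum_app, !lsum_repeat, !S_INR, plus_INR. lra. }
  assert (HM : 0 < INR M) by (apply lt_0_INR; lia).
  set (p := lsum padded / INR (2 * M)).
  assert (Hlsum : lsum padded = INR (2 * M) * p).
  { unfold p. rewrite mult_INR. simpl (INR 2). field. lra. }
  assert (Hp : 0 <= p <= 1 / 2).
  { pose proof (unit_list_lsum padded Hunit). rewrite mult_INR in Hlsum.
    simpl (INR 2) in Hlsum. split; nra. }
  rewrite <- (pb_tail_app_ones_zeros (S n) (S (2 * k)) l). fold padded.
  replace (S n + S k)%nat with (S M) by lia.
  apply Rle_trans with (binomial_tail (2 * M) p (S M)).
  - rewrite <- Hlen. apply pb_tail_le_binomial_tail; rewrite ?Hlen; lra || assumption.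
  - apply Rle_trans with (2 := binomial_tail_fair M).
    apply binomial_tail_nondecreasing; lra || lia.
Qed.

Lemma unit_list_complement (l : list R) : unit_list l -> unit_list (map (Rminus 1) l).
Proof. intros Hl. apply Forall_map. revert Hl. apply Forall_impl. intros x Hx. lra. Qed.

Lemma lsum_complement (l : list R) : lsum (map (Rminus 1) l) = INR (length l) - lsum l.
Proof.
  induction l as [|x l IH]; [simpl; ring|].
  rewrite map_cons, !lsum_cons, IH. simpl length. rewrite S_INR. ring.
Qed.

Lemma pb_tail_ge_half (l : list R) (k : nat) :
  unit_list l -> INR k <= lsum l -> 1 / 2 <= pb_tail l k.
Proof.
  intros Hl Hk.
  assert (Hkn : (k <= length l)%nat) by (apply INR_le; pose proof (unit_list_lsum l Hl); lra).
  pose proof (pb_tail_complement l k (S (length l - k)) ltac:(lia)) as Hsum.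
  assert (Hle := pb_tail_le_half _ (length l - k) (unit_list_complement l Hl)).
  rewrite lsum_complement, minus_INR in Hle by exact Hkn. lra.
Qed.

Lemma pb_tail_le_binomial_tail_pred (p : R) (l : list R) (k : nat) :
  0 <= p <= 1 -> unit_list l -> lsum l = INR (length l) * p ->
  binomial_tail (length l) p (S k) < 1 / 2 ->
  pb_tail l (S (S k)) <= binomial_tail (length l) p (S k).
Proof.
  intros Hp Hl Hmean Hhalf.
  assert (Hbin : unit_list (repeat p (length l))) by now apply unit_list_repeat.
  assert (Hk : lsum l <= INR (S k)).
  { apply Rnot_lt_le. intros Hlt. apply Rlt_not_le in Hhalf.
    apply Hhalf, pb_tail_ge_half; auto. rewrite lsum_repeat. lra. }
  apply Rle_trans with (binomial_tail (length l) p (S (S k))).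
  - now apply pb_tail_le_binomial_tail.
  - apply pb_tail_antitone; auto.
Qed.

(** * Coverage probability *)

Lemma lsum_bvecs (n i : nat) (q : nat -> R) (f : nat -> R) :
  lsum (map (fun t => f (nsucc t) * bern_weight q i t) (bvecs n))
  = pb_expect (map q (seq i n)) f.
Proof.
  revert i f; induction n as [|n IH]; intros i f; [simpl; unfold nsucc; simpl; ring|].
  simpl bvecs. simpl seq. rewrite map_app, lsum_app, !map_map, map_cons, pb_expect_cons.
  rewrite <- !IH, <- !lsum_map_scal.
  f_equal; f_equal; apply map_ext; intros t; unfold nsucc; simpl; ring.
Qed.

Lemma prob_sum_event_pb_expect (n : nat) (q : nat -> R) (E : nat -> Prop)
  (Edec : forall k, {E k} + {~ E k}) :
  prob_sum_event n q E Edec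
  = pb_expect (map q (seq 0 n)) (fun k => if Edec k then 1 else 0).
Proof.
  rewrite <- lsum_bvecs. unfold prob_sum_event, lsum. f_equal. apply map_ext. intros t.
  destruct (Edec (nsucc t)); ring.
Qed.

Lemma prob_sum_event_ge (n : nat) (q : nat -> R) (E : nat -> Prop)
  (Edec : forall k, {E k} + {~ E k}) (k0 : nat) :
  unit_list (map q (seq 0 n)) -> (forall k, (k <= n)%nat -> (k < k0)%nat -> E k) ->
  1 - pb_tail (map q (seq 0 n)) k0 <= prob_sum_event n q E Edec.
Proof.
  intros Hq HE. rewrite prob_sum_event_pb_expect. set (l := map q (seq 0 n)) in *.
  assert (Hlen : length l = n) by (unfold l; now rewrite length_map, length_seq).
  rewrite <- (pb_expect_const l 1) at 1. unfold pb_tail.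
  rewrite <- pb_expect_minus. apply pb_expect_le; [exact Hq|]. intros k Hk.
  destruct (Edec k) as [Hin|Hout], (Nat.leb_spec k0 k); try lra.
  exfalso. apply Hout, HE; lia.
Qed.

Lemma lsum_map_seq (n : nat) (q : nat -> R) : lsum (map q (seq 0 (S n))) = sum_f_R0 q n.
Proof.
  induction n as [|n IH]; [simpl; ring|].
  rewrite seq_S, map_app, lsum_app, IH. simpl. ring.
Qed.

Lemma lsum_qbar (n : nat) (q : nat -> R) :
  (1 <= n)%nat -> lsum (map q (seq 0 n)) = INR n * qbar n q.
Proof.
  intros Hn. unfold qbar. destruct n as [|n]; [lia|].
  rewrite lsum_map_seq, Nat.sub_1_r. simpl pred. field. now apply not_0_INR.
Qed.

Lemma first_exceedance (f : nat -> R) (c : R) (n : nat) :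
  exists k, (forall i, (i < k)%nat -> f i <= c) /\ (k = n \/ (k < n)%nat /\ c < f k).
Proof.
  induction n as [|n (k & Hbelow & Hk)]; [exists 0%nat; split; [lia|now left]|].
  destruct Hk as [->|[Hk Hc]]; [|exists k; split; [exact Hbelow|right; auto with arith]].
  destruct (Rle_lt_dec (f n) c) as [H|H]; [exists (S n)|exists n]; (split; [|auto with arith]).
  - intros i Hi. destruct (Nat.eq_dec i n) as [->|]; [exact H|apply Hbelow; lia].
  - exact Hbelow.
Qed.

Theorem theorem2 (n : nat) (q : nat -> R) (alpha : R) (qhat : nat -> R) :
  (1 <= n)%nat ->
  (forall i, (i < n)%nat -> 0 <= q i <= 1) ->
  0 <= alpha <= 1 / 2 ->
  qhat 0%nat = 0 ->
  qhat 1%nat = 0 ->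
  (forall k, (2 <= k <= n)%nat ->
     is_incbeta_inv (k - 1) (n - k + 2) alpha (qhat k)) ->
  prob_sum_event n q (fun k => qhat k <= qbar n q)
    (fun k => Rle_dec (qhat k) (qbar n q)) >= 1 - alpha.
Proof.
  intros Hn Hq Halpha Hqhat0 Hqhat1 Hqhat.
  set (p := qbar n q). set (l := map q (seq 0 n)).
  assert (Hlen : length l = n) by (unfold l; now rewrite length_map, length_seq).
  assert (Hl : unit_list l).
  { apply Forall_map, Forall_forall. intros i Hi. apply in_seq in Hi. apply Hq. lia. }
  assert (Hmean : lsum l = INR (length l) * p) by (rewrite Hlen; now apply lsum_qbar).
  assert (Hp : 0 <= p <= 1) by (apply (unit_list_mean l p Hl); [lia|exact Hmean]).
  destruct (first_exceedance qhat p (S n)) as (k & Hbelow & Hk).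
  apply Rle_ge, Rle_trans with (1 - pb_tail l k); [|now apply prob_sum_event_ge; auto].
  enough (pb_tail l k <= alpha) by lra.
  destruct Hk as [->|[Hkn Habove]]; [rewrite pb_tail_gt_length by lia; lra|].
  destruct k as [|[|k]]; [lra|lra|].
  assert (Hbin : binomial_tail (length l) p (S k) < alpha).
  { rewrite Hlen. apply (binomial_tail_lt_of_lt_incbeta_inv _ _ _ _ (qhat (S (S k))));
      try lra || lia.
    replace (n - S k + 1)%nat with (n - S (S k) + 2)%nat by lia. apply Hqhat. lia. }
  apply Rle_trans with (binomial_tail (length l) p (S k)); [|lra].
  apply pb_tail_le_binomial_tail_pred; lra || assumption.
Qed.
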